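(* Let $f=\frac1n\sum_{i=1}^n f_i$ where each $f_i:\mathbb{R}^d\to\mathbb{R}$ is convex and $L_i$-smooth, assume that $f$ is $\mu$-strongly convex ($\mu>0$) with minimizer $x^*$, and let $L_{\max}=\max_{1\le i\le n}L_i$. Then SGD with $\text{SPS}_{\max}$ with $c=1/2$ and $0<\gamma_b\le\frac{1}{L_{\max}}$ becomes SGD with constant step-size $\gamma_k=\gamma:=\gamma_b\le\frac1{L_{\max}}$, and its iterates satisfy, for all $k\ge0$, $$\mathbb{E}\|x^{k}-x^*\|^2\le(1-\mu\gamma)^k\|x^0-x^*\|^2+\frac{2\sigma^2}{\mu}.$$ If in addition interpolation holds ($\sigma=0$), the iterates of SGD with constant step-size $\gamma\le\frac1{L_{\max}}$ satisfy $$\mathbb{E}\|x^{k}-x^*\|^2\le(1-\mu\gamma)^k\|x^0-x^*\|^2.$$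
   Context: Setting: $f(x)=\frac1n\sum_{i=1}^n f_i(x)$ is minimized over $\mathbb{R}^d$, and the set $\mathcal{X}^*$ of minimizers of $f$ is nonempty. A function is $L$-smooth if it is differentiable with $L$-Lipschitz gradient. For each $i$, $f_i^*:=\inf_x f_i(x)$, and it is assumed throughout that $\sigma^2:=\mathbb{E}_i[f_i(x^* )-f_i^*]=f(x^* )-\frac1n\sum_{i=1}^n f_i^*<\infty$ (so all $f_i^*$ are finite), where $x^*\in\mathcal{X}^*$. SGD: starting from a deterministic $x^0$, at each iteration $k$ an index $i\in\{1,\dots,n\}$ is drawn uniformly at random, independently of the past, and $x^{k+1}=x^k-\gamma_k\nabla f_i(x^k)$. $\text{SPS}_{\max}$ with parameters $c>0$ and $\gamma_b>0$: $\gamma_k=\min\left\{\frac{f_i(x^k)-f_i^*}{c\|\nabla f_i(x^k)\|^2},\gamma_b\right\}$, where $i$ is the index drawn at iteration $k$. If $\nabla f_i(x^k)=0$ then $x^{k+1}=x^k$ (so any value, e.g. $\gamma_b$, may be assigned to $\gamma_k$). *)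

(* Defs.v *)
From HB Require Import structures.
From mathcomp Require Import all_boot all_order all_algebra.
From mathcomp Require Import finmap.
From mathcomp Require Import all_classical all_reals all_analysis.

Set Implicit Arguments.
Unset Strict Implicit.
Unset Printing Implicit Defensive.

Import Order.TTheory GRing.Theory Num.Theory.
Import numFieldNormedType.Exports.

Local Open Scope classical_set_scope.
Local Open Scope ring_scope.

(* The library norm on 'rV[R]_d is the sup norm, so the Euclidean norm is
   defined here.  Differentiability does not depend on this choice. *)
Definition enorm (R : realType) (d : nat) (u : 'rV[R]_d) : R :=
  Num.sqrt (\sum_(j < d) u 0 j ^+ 2).

Definition grad (R : realType) (d : nat) (g : 'rV[R]_d -> R) (x : 'rV[R]_d) :
  'rV[R]_d := \row_(j < d) 'D_(delta_mx 0 j) g x.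

Definition smooth (R : realType) (d : nat) (L : R) (g : 'rV[R]_d -> R) : Prop :=
  [/\ 0 <= L,
      forall x, differentiable g x &
      forall x y, enorm (grad g x - grad g y) <= L * enorm (x - y)].

Definition convex (R : realType) (d : nat) (g : 'rV[R]_d -> R) : Prop :=
  convex_function (setT : set (convex_lmodType 'rV[R]_d)) g.

Definition strongly_convex (R : realType) (d : nat) (mu : R)
    (g : 'rV[R]_d -> R) : Prop :=
  forall (x y : 'rV[R]_d) (t : R), 0 <= t <= 1 ->
    g (t *: x + (1 - t) *: y) <=
      t * g x + (1 - t) * g y - mu / 2 * t * (1 - t) * enorm (x - y) ^+ 2.

Definition minimizer (R : realType) (d : nat) (g : 'rV[R]_d -> R)
  (x : 'rV[R]_d) : Prop := forall y, g x <= g y.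

Section finite_sum.
Context {R : realType} {d n : nat}.
Implicit Types (f : 'I_n -> 'rV[R]_d -> R) (x : 'rV[R]_d).

Definition favg f x : R := n%:R^-1 * \sum_(i < n) f i x.

(* [inf] is the infimum of [f i] only when [f i] is bounded below. *)
Definition fstar f (i : 'I_n) : R := inf (range (f i)).

(* The index average E_i[f_i(x) - f_i^*]; sigma^2 is its value at x^*. *)
Definition sigma2 f x : R := n%:R^-1 * \sum_(i < n) (f i x - fstar f i).

(* The default 0 is harmless: the constants of [smooth] are nonnegative. *)
Definition Lmax (L : 'I_n -> R) : R := \big[Num.max/0]_(i < n) L i.

(* SGD along a given index sequence [idx]; the step-size used at iteration k is
   [step (idx k) x^k]. *)
Fixpoint sgd f (step : 'I_n -> 'rV[R]_d -> R) x0 (idx : nat -> 'I_n) (k : nat)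
    : 'rV[R]_d :=
  if k is k'.+1 then
    let x := sgd f step x0 idx k' in
    x - step (idx k') x *: grad (f (idx k')) x
  else x0.

Definition const_step (gamma : R) (i : 'I_n) x : R := gamma.

(* When the stochastic gradient vanishes the quotient is meaningless, and the
   iterate does not move whatever the step-size; it is set to [gb]. *)
Definition sps_max f (c gb : R) (i : 'I_n) x : R :=
  if grad (f i) x == 0 then gb
  else Num.min ((f i x - fstar f i) / (c * enorm (grad (f i) x) ^+ 2)) gb.

End finite_sum.

Definition iid_uniform (R : realType) (n : nat) (disp : measure_display)
    (T : measurableType disp) (P : probability T R) (I : nat -> T -> 'I_n) : Prop :=
  [/\ forall k (A : set 'I_n), measurable (I k @^-1` A),
      forall k i, P (I k @^-1` [set i]) = (n%:R^-1)%:E &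
      forall (J : {fset nat}) (A : nat -> set 'I_n),
        P (\bigcap_(k in [set` J]) (I k @^-1` A k)) =
        (\prod_(k <- J) P (I k @^-1` A k))%E].

(* Main.v *)
Require Import Defs.
From mathcomp Require Import all_boot all_order all_algebra finmap.
From mathcomp Require Import all_classical all_reals all_analysis.
From mathcomp Require Import measurable_realfun ring lra.

Import Order.TTheory GRing.Theory Num.Theory.
Import numFieldNormedType.Exports.

Local Open Scope classical_set_scope.
Local Open Scope ring_scope.

(** An M-smooth function g that is bounded below satisfies
    |grad g x|^2 <= 2 M (g x - inf g): a gradient step of length 1 / M
    decreases g by at least |grad g x|^2 / (2 M) ([smooth_sqr_grad_le]).  Taken
    with M = Lmax, this says that the quotient in the Polyak step-size with
    c = 1/2 is at least 1 / Lmax, so that the minimum is gamma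
    ([sps_max_half]).

    For the rate, expand |x - gamma grad f_i(x) - xstar|^2.  The same bound,
    together with gamma <= 1 / Lmax, controls the quadratic term by
    2 gamma (f_i x - inf f_i); strong convexity controls the average over i of
    the cross term by f xstar - f x - mu/2 |x - xstar|^2.  The values f x
    cancel, and one step started at x has mean squared distance at most
    q |x - xstar|^2 + 2 gamma sigma^2, where q = 1 - mu gamma
    ([sgd_step_contraction]).  When d > 0 this bound, being nonnegative for
    every x, forces q >= 0; when d = 0 all distances vanish.

    The k-th iterate depends only on the first k indices, whose joint law is
    uniform on the k-tuples, so the expectation is a finite average over
    k-tuples ([expectation_iid_uniform]).  Splitting off the first index gives,
    by induction on k, the bound
    q^k |x0 - xstar|^2 + (2 sigma^2 / mu) (1 - q^k) ([path_average_le]). *)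

Set Implicit Arguments.
Unset Strict Implicit.

(** * Euclidean inner product *)

(** The inner product inducing [enorm]. *)
Definition edot (R : realType) (d : nat) (u v : 'rV[R]_d) : R :=
  \sum_(j < d) u 0 j * v 0 j.

Section euclidean.
Context {R : realType} {d : nat}.
Implicit Types (u v w : 'rV[R]_d) (a : R).

Lemma enorm_ge0 u : 0 <= enorm u.
Proof. exact: sqrtr_ge0. Qed.

Lemma sqr_enorm u : enorm u ^+ 2 = edot u u.
Proof.
rewrite sqr_sqrtr; first by apply: eq_bigr => j _; rewrite expr2.
by apply: sumr_ge0 => j _; rewrite sqr_ge0.
Qed.

Lemma edotC u v : edot u v = edot v u.
Proof. by apply: eq_bigr => j _; rewrite mulrC. Qed.

Lemma edotDl u v w : edot (u + v) w = edot u w + edot v w.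
Proof. by rewrite -big_split; apply: eq_bigr => j _; rewrite mxE mulrDl. Qed.

Lemma edotZl a u v : edot (a *: u) v = a * edot u v.
Proof. by rewrite mulr_sumr; apply: eq_bigr => j _; rewrite mxE mulrA. Qed.

Lemma edotNl u v : edot (- u) v = - edot u v.
Proof. by rewrite -scaleN1r edotZl mulN1r. Qed.

Lemma edotBl u v w : edot (u - v) w = edot u w - edot v w.
Proof. by rewrite edotDl edotNl. Qed.

Lemma edotDr u v w : edot w (u + v) = edot w u + edot w v.
Proof. by rewrite !(edotC w) edotDl. Qed.

Lemma edotZr a u v : edot v (a *: u) = a * edot v u.
Proof. by rewrite !(edotC v) edotZl. Qed.

Lemma edotNr u v : edot u (- v) = - edot u v.
Proof. by rewrite !(edotC u) edotNl. Qed.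

Lemma edot0l u : edot 0 u = 0.
Proof. by rewrite -(scale0r u) edotZl mul0r. Qed.

Lemma enormZ a u : enorm (a *: u) = `|a| * enorm u.
Proof.
apply/eqP; rewrite -(eqrXn2 (n := 2)) ?mulr_ge0 ?enorm_ge0 //.
by rewrite exprMn !sqr_enorm edotZl edotZr mulrA -expr2 real_normK ?num_real.
Qed.

Lemma enormN u : enorm (- u) = enorm u.
Proof. by rewrite -scaleN1r enormZ normrN1 mul1r. Qed.

Lemma enorm0 : enorm (0 : 'rV[R]_d) = 0.
Proof. by rewrite -(scale0r 0) enormZ normr0 mul0r. Qed.

Lemma enorm_eq0 u : (enorm u == 0) = (u == 0).
Proof.
apply/eqP/eqP => [u0|->]; last exact: enorm0.
have := sqr_enorm u; rewrite u0 expr0n /= => /esym/eqP.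
rewrite psumr_eq0 => [/allP h|j _]; last by rewrite -expr2 sqr_ge0.
apply/rowP => j; rewrite mxE; apply/eqP.
by have := h j (mem_index_enum _); rewrite /= -expr2 sqrf_eq0.
Qed.

Lemma sqr_enormB u v :
  enorm (u - v) ^+ 2 = enorm u ^+ 2 - 2 * edot u v + enorm v ^+ 2.
Proof.
rewrite !sqr_enorm edotBl !edotDr !edotNr (edotC v u); ring.
Qed.

(** Cauchy-Schwarz inequality. *)
Lemma edot_le_enorm u v : edot u v <= enorm u * enorm v.
Proof.
have [->|u0] := eqVneq u 0; first by rewrite edot0l enorm0 mul0r.
have [->|v0] := eqVneq v 0; first by rewrite edotC edot0l enorm0 mulr0.
have pu : 0 < enorm u by rewrite lt0r enorm_eq0 u0 enorm_ge0.
have pv : 0 < enorm v by rewrite lt0r enorm_eq0 v0 enorm_ge0.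
(* expand the square of |v| u - |u| v and divide by 2 |u| |v| *)
have := sqr_ge0 (enorm (enorm v *: u - enorm u *: v)).
rewrite sqr_enormB !enormZ edotZl edotZr !ger0_norm ?enorm_ge0 //.
have puv := mulr_gt0 pu pv; set e := edot u v => h.
rewrite -subr_ge0 -(pmulr_rge0 _ puv); nra.
Qed.

End euclidean.

(** * Quadratic bounds for smooth functions *)

Section smoothness.
Context {R : realType} {d : nat}.
Implicit Types (g : 'rV[R]_d -> R) (x y u v : 'rV[R]_d) (L : R).

Lemma derive_edot_grad g x v :
  differentiable g x -> 'D_v g x = edot (grad g x) v.
Proof.
move=> dg; rewrite deriveE // [in LHS](row_sum_delta v) linear_sum.
by apply: eq_bigr => j _; rewrite linearZ /= mxE deriveE // mulrC.
Qed.

Lemma is_derive_line g x v (t : R) : differentiable g (x + t *: v) ->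
  is_derive t 1 (fun s : R => g (x + s *: v)) (edot (grad g (x + t *: v)) v).
Proof.
move=> dg; rewrite -derive_edot_grad //.
(* the two difference quotients agree before passing to the limit *)
have E : (fun h : R => h^-1 *: (g (x + (h *: 1 + t) *: v) - g (x + t *: v))) =
         (fun h : R => h^-1 *: (g (h *: v + (x + t *: v)) - g (x + t *: v))).
  by apply/funext => h; rewrite scalerDl -scalerA scale1r addrCA.
apply: DeriveDef; last by rewrite /derive /= E.
by rewrite /derivable /= E; exact: diff_derivable.
Qed.

Lemma le_quadratic_of_derive (h dh : R -> R) (a K : R) :
  (forall s : R, is_derive s 1 h (dh s)) ->
  (forall s, 0 <= s -> dh s <= a + K * s) ->
  h 1 <= h 0 + a + K / 2.
Proof.
move=> hd dh_le.
pose p : R -> R := fun s => h s - (a * s + K / 2 * s ^+ 2).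
have pd (s : R) : is_derive s 1 p (dh s - (a + K * s)).
  rewrite /p; apply: is_deriveB; apply: is_derive_eq.
  by rewrite /GRing.scale /=; field.
(* mean value theorem for p, whose derivative is nonpositive on [0, 1] *)
have [|c /[!in_itv]/= /andP[c0 _]] := @MVT_segment R p _ 0 1 ler01 (fun s _ => pd s).
  by apply: derivable_within_continuous => s _; exact: ex_derive.
rewrite /p; have := dh_le c c0; nra.
Qed.

Lemma smooth_le g L L' : smooth L g -> L <= L' -> smooth L' g.
Proof.
move=> [L0 dg lg] LL'; split=> //; first exact: le_trans LL'.
by move=> x y; apply: le_trans (lg x y) _; rewrite ler_wpM2r ?enorm_ge0.
Qed.

(** Descent lemma. *)
Lemma smooth_le_quadratic g L x u : smooth L g ->
  g (x + u) <= g x + edot (grad g x) u + L / 2 * enorm u ^+ 2.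
Proof.
move=> [L0 dg lg].
have := @le_quadratic_of_derive _ _ (edot (grad g x) u) (L * enorm u ^+ 2)
  (fun s => is_derive_line (dg (x + s *: u))).
rewrite scale1r scale0r addr0 mulrAC; apply=> s s0.
rewrite -lerBlDl -edotBl; apply: le_trans (edot_le_enorm _ _) _.
have := lg (x + s *: u) x.
rewrite addrAC subrr add0r enormZ ger0_norm // => h.
apply: le_trans (ler_wpM2r (enorm_ge0 _) h) _.
by rewrite le_eqVlt; apply/orP; left; apply/eqP; ring.
Qed.

Lemma smooth_ge_quadratic g L x u : smooth L g ->
  g x + edot (grad g x) u - L / 2 * enorm u ^+ 2 <= g (x + u).
Proof.
move=> [L0 dg lg].
have dN (t : R) : is_derive t 1 (fun s : R => - g (x + s *: u))
     (- edot (grad g (x + t *: u)) u).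
  by apply: is_deriveN; exact: is_derive_line.
have := @le_quadratic_of_derive _ _ (- edot (grad g x) u) (L * enorm u ^+ 2) dN.
rewrite scale1r scale0r addr0 => h.
suff /h : forall s, 0 <= s ->
  - edot (grad g (x + s *: u)) u <= - edot (grad g x) u + L * enorm u ^+ 2 * s.
  lra.
move=> s s0; rewrite -lerBlDl opprK addrC -edotBl.
apply: le_trans (edot_le_enorm _ _) _.
have := lg x (x + s *: u).
rewrite opprD addrA subrr add0r enormN enormZ ger0_norm // => {}h.
apply: le_trans (ler_wpM2r (enorm_ge0 _) h) _.
by rewrite le_eqVlt; apply/orP; left; apply/eqP; ring.
Qed.

(** The gradient is controlled by the suboptimality gap. *)
Lemma smooth_sqr_grad_le g L x : smooth L g -> 0 < L ->
  has_lbound (range g) ->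
  enorm (grad g x) ^+ 2 <= 2 * L * (g x - inf (range g)).
Proof.
move=> sg L0 bg.
(* one gradient step of length 1 / L decreases g by at least |grad|^2 / (2 L) *)
have := smooth_le_quadratic x (- L^-1 *: grad g x) sg.
have := ge_inf bg (imageT g (x + - L^-1 *: grad g x)).
rewrite edotZr enormZ -sqr_enorm exprMn real_normK ?num_real //.
set e := enorm _ ^+ 2; set y := g (_ + _); set m := inf _ => h1 h2.
have : m <= g x - e / (2 * L).
  apply: le_trans h1 (le_trans h2 _); rewrite le_eqVlt; apply/orP; left.
  by apply/eqP; field; rewrite gt_eqF.
by rewrite lerBrDr -lerBrDl ler_pdivrMr ?mulr_gt0 // mulrC.
Qed.

End smoothness.

(** * One step of stochastic gradient descent *)

Lemma average_const (R : realType) (n : nat) (a : R) :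
  (0 < n)%N -> n%:R^-1 * \sum_(i < n) a = a.
Proof.
move=> n0; rewrite sumr_const card_ord -(mulr_natl a) mulKf //.
by rewrite pnatr_eq0 -lt0n.
Qed.

Section sgd_step.
Context {R : realType} {d n : nat}.
Implicit Types (f : 'I_n -> 'rV[R]_d -> R) (x y : 'rV[R]_d) (L : 'I_n -> R).

Lemma le_Lmax L i : L i <= Lmax L.
Proof. exact: le_bigmax. Qed.

(** [Lmax L = 0] is excluded because then [1 / Lmax L = 0 < gamma]. *)
Lemma Lmax_gt0 L (gamma : R) : 0 < gamma -> gamma <= 1 / Lmax L -> 0 < Lmax L.
Proof.
by move=> g0 /(lt_le_trans g0); rewrite div1r invr_gt0.
Qed.

Lemma sigma2_ge0 f x : (forall i, has_lbound (range (f i))) -> 0 <= sigma2 f x.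
Proof.
move=> bf; rewrite mulr_ge0 ?invr_ge0 // sumr_ge0 // => i _.
by rewrite subr_ge0; apply: ge_inf => //; exists x.
Qed.

Lemma sps_max_half f (M gamma : R) i x :
  smooth M (f i) -> has_lbound (range (f i)) -> 0 < M -> gamma <= 1 / M ->
  sps_max f (1 / 2) gamma i x = gamma.
Proof.
move=> sf bf M0 gM; rewrite /sps_max; case: ifPn => // g0.
apply/min_idPr; apply: le_trans gM _.
have e0 : 0 < enorm (grad (f i) x) ^+ 2.
  by rewrite exprn_gt0 // lt0r enorm_eq0 g0 enorm_ge0.
have := smooth_sqr_grad_le x sf M0 bf; rewrite -/(fstar f i) => h.
move: (enorm _ ^+ 2) e0 h => e e0 h.
rewrite ler_pdivlMr ?mulr_gt0 //.
have -> : 1 / M * (1 / 2 * e) = e / (2 * M).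
  by field; rewrite gt_eqF.
by rewrite ler_pdivrMr ?mulr_gt0 // mulrC.
Qed.

(** First-order form of strong convexity, with the gradient of the average
    written as the average of the gradients.  Smoothness of the summands
    replaces the differentiation of the average: their quadratic lower bounds
    at [x] are averaged along the segment from [x] to [y] and compared with
    the strong convexity inequality there. *)
Lemma strongly_convex_edot_grad f (mu M : R) x y :
  (forall i, smooth M (f i)) -> strongly_convex mu (favg f) ->
  favg f x - favg f y + mu / 2 * enorm (x - y) ^+ 2 <=
  n%:R^-1 * \sum_(i < n) edot (grad (f i) x) (x - y).
Proof.
move=> sf sc.
have [n0|n_gt0] := posnP n.
  subst n; have half01 : 0 <= (2^-1 : R) <= 1.
    by apply/andP; split; lra.
  have := sc x y 2^-1 half01; rewrite /favg !big_ord0; lra.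
set e := enorm _ ^+ 2; set D := n%:R^-1 * \sum_(i < n) _.
have seg (t : R) : 0 < t -> t <= 1 ->
    favg f x - favg f y + mu / 2 * e <= D + t * (M / 2 * e + mu / 2 * e).
  move=> t0 t1.
  have low : favg f x - t * D - M / 2 * t ^+ 2 * e <= favg f (t *: y + (1 - t) *: x).
    have -> : t *: y + (1 - t) *: x = x + - t *: (x - y).
      by apply/rowP => j; rewrite !mxE; ring.
    rewrite /favg /D mulrCA -mulrBr.
    have -> : M / 2 * t ^+ 2 * e = n%:R^-1 * \sum_(i < n) (M / 2 * t ^+ 2 * e).
      by rewrite average_const.
    rewrite -mulrBr mulr_sumr -!sumrB ler_wpM2l ?invr_ge0 // ler_sum // => i _.
    have := smooth_ge_quadratic x (- t *: (x - y)) (sf i).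
    rewrite edotZr enormZ exprMn real_normK ?num_real // -/e; lra.
  have := sc y x t; rewrite (ltW t0) t1 => /(_ isT).
  rewrite -[enorm (y - x)]enormN opprB -/e => up.
  have := le_trans low up.
  rewrite -(ler_pM2l t0); nra.
(* [seg] bounds A by D + t B for small t > 0, which is absurd if D < A *)
set A := favg f x - _ + _ in seg *; set B := M / 2 * e + _ in seg.
rewrite leNgt; apply/negP => DA.
pose t := Num.min 1 ((A - D) / (2 * (`|B| + 1))).
have B1 : 0 < `|B| + 1 by rewrite ltr_wpDl.
have t0 : 0 < t by rewrite lt_min ltr01 divr_gt0 ?subr_gt0 ?mulr_gt0.
have tle : t * (2 * (`|B| + 1)) <= A - D.
  by rewrite -ler_pdivlMr ?mulr_gt0 // ge_min lexx orbT.
have := seg t t0; rewrite ge_min lexx => /(_ isT).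
have : t * B <= t * `|B| by rewrite ler_pM2l // ler_norm.
nra.
Qed.

(** The iterate that follows [x] when the index [i] is drawn. *)
Definition sgd_step f (gamma : R) i x := x - gamma *: grad (f i) x.

(** The point [y] need not be a minimizer: the values of the average at [x]
    cancel, and [sigma2 f y] absorbs the value at [y]. *)
Lemma sgd_step_contraction f (mu M gamma : R) x y :
  (0 < n)%N -> (forall i, smooth M (f i)) ->
  (forall i, has_lbound (range (f i))) -> strongly_convex mu (favg f) ->
  0 < M -> 0 < gamma -> gamma <= 1 / M ->
  n%:R^-1 * \sum_(i < n) enorm (sgd_step f gamma i x - y) ^+ 2 <=
  (1 - mu * gamma) * enorm (x - y) ^+ 2 + 2 * gamma * sigma2 f y.
Proof.
move=> n_gt0 sf bf sc M0 g0 gM.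
set e := enorm (x - y) ^+ 2.
have one i : enorm (sgd_step f gamma i x - y) ^+ 2 <=
    e - 2 * gamma * edot (grad (f i) x) (x - y)
      + 2 * gamma * (f i x - fstar f i).
  rewrite /sgd_step addrAC sqr_enormB -/e edotZr enormZ gtr0_norm // exprMn.
  rewrite (edotC (x - y)) mulrA; rewrite lerD2l.
  have := smooth_sqr_grad_le x (sf i) M0 (bf i); rewrite -/(fstar f i).
  set s := enorm _ ^+ 2; set D := f i x - _ => h.
  have D0 : 0 <= D by rewrite subr_ge0; apply: ge_inf => //; exists x.
  have gM1 : gamma * M <= 1 by rewrite -ler_pdivlMr.
  rewrite expr2 -mulrA (mulrC 2) -[in leRHS]mulrA ler_pM2l //.
  apply: le_trans (ler_wpM2l (ltW g0) h) _; nra.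
apply: le_trans (_ : n%:R^-1 * \sum_(i < n) (e - 2 * gamma *
    edot (grad (f i) x) (x - y) + 2 * gamma * (f i x - fstar f i)) <= _).
  by rewrite ler_wpM2l ?invr_ge0 // ler_sum.
rewrite big_split /= sumrB mulrDr mulrBr average_const // -!mulr_sumr.
rewrite !(mulrCA _ (2 * gamma)).
have := strongly_convex_edot_grad x y sf sc; rewrite -/e.
set D := n%:R^-1 * \sum_(i < n) edot _ _ => h.
have -> : n%:R^-1 * \sum_(i < n) (f i x - fstar f i) =
          favg f x - favg f y + sigma2 f y.
  by rewrite /favg /sigma2 !sumrB !mulrBr; ring.
nra.
Qed.

(** The bound of [sgd_step_contraction] is nonnegative however far the starting
    point is. *)
Lemma contraction_factor_ge0 f (mu M gamma : R) :
  (0 < d)%N -> (0 < n)%N -> (forall i, smooth M (f i)) ->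
  (forall i, has_lbound (range (f i))) -> strongly_convex mu (favg f) ->
  0 < M -> 0 < gamma -> gamma <= 1 / M ->
  0 <= 1 - mu * gamma.
Proof.
move=> d_gt0 n_gt0 sf bf sc M0 g0 gM; rewrite leNgt; apply/negP => q0.
pose u : 'rV[R]_d := const_mx 1.
have u0 : 0 < enorm u ^+ 2.
  rewrite exprn_gt0 // lt0r enorm_ge0 enorm_eq0 andbT.
  apply/eqP => /rowP/(_ (Ordinal d_gt0)); rewrite !mxE => /eqP.
  by rewrite oner_eq0.
set q := 1 - _ in q0.
pose C := 2 * gamma * sigma2 f 0.
have C0 : 0 <= C by rewrite mulr_ge0 ?sigma2_ge0 // mulr_ge0 // ltW.
have key (r : R) : 0 <= q * (r ^+ 2 * enorm u ^+ 2) + C.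
  have := sgd_step_contraction (r *: u) 0 n_gt0 sf bf sc M0 g0 gM.
  rewrite subr0 enormZ exprMn real_normK ?num_real //; apply: le_trans.
  by rewrite mulr_ge0 ?invr_ge0 // sumr_ge0 // => i _; rewrite sqr_ge0.
(* starting at distance squared a |u|^2 would make the bound equal to -1 *)
pose a := (C + 1) / (- q * enorm u ^+ 2).
have qu : 0 < - q * enorm u ^+ 2 by rewrite mulr_gt0 // oppr_gt0.
have a0 : 0 <= a by rewrite divr_ge0 ?ltW // ltr_wpDl.
have := key (Num.sqrt a); rewrite sqr_sqrtr //.
have : a * (- q * enorm u ^+ 2) = C + 1 by rewrite divfK // gt_eqF.
lra.
Qed.

End sgd_step.

(** * Averages over index paths *)

Section paths.
Context {R : realType} {d n : nat}.
Implicit Types (f : 'I_n -> 'rV[R]_d -> R) (y : 'rV[R]_d).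

Lemma eq_sgd f step x0 (idx idx' : nat -> 'I_n) k :
  (forall j, (j < k)%N -> idx j = idx' j) ->
  sgd f step x0 idx k = sgd f step x0 idx' k.
Proof.
elim: k => [|k IH] e; first by [].
rewrite /= IH => [|j jk]; first by rewrite (e k (ltnSn k)).
exact: e (ltnW jk).
Qed.

(** Constant-step iterates, unfolded at the first index, not the last. *)
Lemma sgd_first f (gamma : R) x0 (idx : nat -> 'I_n) k :
  sgd f (const_step gamma) x0 idx k.+1 =
  sgd f (const_step gamma) (sgd_step f gamma (idx 0) x0) (idx \o S) k.
Proof.
elim: k => [|k IH]; first by [].
by rewrite [LHS]/= -/(sgd f (const_step gamma) x0 idx k.+1) IH.
Qed.

(** The squared distance to [y] of the k-th constant-step iterate, averaged
    over all index paths of length [k].  The default index [i0] only serves to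
    read a tuple as an infinite sequence. *)
Definition path_average (i0 : 'I_n) f (gamma : R) (y x0 : 'rV[R]_d) k : R :=
  \sum_(s : k.-tuple 'I_n) n%:R^-1 ^+ k *
     enorm (sgd f (const_step gamma) x0 (nth i0 s) k - y) ^+ 2.

Lemma big_tupleS k (F : k.+1.-tuple 'I_n -> R) :
  \sum_(s : k.+1.-tuple 'I_n) F s =
  \sum_(i < n) \sum_(s : k.-tuple 'I_n) F [tuple of i :: s].
Proof.
rewrite pair_big /=.
rewrite (reindex (fun p : 'I_n * k.-tuple 'I_n => [tuple of p.1 :: p.2])) //=.
exists (fun s => (thead s, [tuple of behead s])) => [[i s] _|s _] /=.
  by congr pair; apply/val_inj.
by rewrite -tuple_eta.
Qed.

Lemma path_averageS i0 f gamma y x0 k :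
  path_average i0 f gamma y x0 k.+1 =
  n%:R^-1 * \sum_(i < n) path_average i0 f gamma y (sgd_step f gamma i x0) k.
Proof.
rewrite /path_average big_tupleS mulr_sumr; apply: eq_bigr => i _.
rewrite mulr_sumr; apply: eq_bigr => s _.
by rewrite sgd_first exprS mulrA.
Qed.

Lemma path_average_le i0 f (mu M gamma : R) y x0 k :
  (forall i, smooth M (f i)) ->
  (forall i, has_lbound (range (f i))) -> strongly_convex mu (favg f) ->
  0 < M -> 0 < mu -> 0 < gamma -> gamma <= 1 / M ->
  path_average i0 f gamma y x0 k <=
  (1 - mu * gamma) ^+ k * enorm (x0 - y) ^+ 2 + 2 * sigma2 f y / mu.
Proof.
move=> sf bf sc M0 mu0 g0 gM.
have n_gt0 : (0 < n)%N by case: (n) i0 => [[]|].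
have S0 : 0 <= 2 * sigma2 f y / mu.
  by rewrite mulr_ge0 ?invr_ge0 ?(ltW mu0) // mulr_ge0 // sigma2_ge0.
(* in dimension 0 the factor 1 - mu gamma may be negative *)
have [d0|d_gt0] := posnP d.
  have e0 (u : 'rV[R]_d) : enorm u = 0.
    by apply/eqP; rewrite enorm_eq0; subst d; apply/eqP/rowP => -[].
  rewrite e0 expr0n mulr0 add0r /path_average big1 // => s _.
  by rewrite e0 expr0n mulr0.
have q0 := contraction_factor_ge0 d_gt0 n_gt0 sf bf sc M0 g0 gM.
have step := sgd_step_contraction _ y n_gt0 sf bf sc M0 g0 gM.
set q := 1 - mu * gamma in q0 step *; set S := _ / mu in S0 *.
(* the factor 1 - q^k is what makes the induction on k close *)
apply: le_trans (_ : q ^+ k * enorm (x0 - y) ^+ 2 + S * (1 - q ^+ k) <= _);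
  last by have := mulr_ge0 S0 (exprn_ge0 k q0); lra.
have gS : 2 * gamma * sigma2 f y = S * (1 - q).
  by rewrite /S /q; field; rewrite gt_eqF.
elim: k x0 => [|k IH] x0.
  rewrite /path_average (big_pred1 [tuple]) => [|s]; last exact/esym/eqP/tuple0.
  by rewrite !expr0 subrr mulr0 addr0 lexx.
rewrite path_averageS.
apply: le_trans (_ : n%:R^-1 * \sum_(i < n)
  (q ^+ k * enorm (sgd_step f gamma i x0 - y) ^+ 2 + S * (1 - q ^+ k)) <= _).
  by rewrite ler_wpM2l ?invr_ge0 // ler_sum.
rewrite big_split /= mulrDr average_const // -mulr_sumr mulrCA.
apply: le_trans (lerD (ler_wpM2l (exprn_ge0 k q0) (step x0)) (lexx _)) _.
rewrite gS le_eqVlt; apply/orP; left; apply/eqP; rewrite (exprS q k); ring.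
Qed.

End paths.

(** * Law of the first k indices *)

Section law.
Context {R : realType} {disp : measure_display} {T : measurableType disp}.
Context (P : probability T R).

Lemma expectation_finType (S : finType) (X : T -> S) (phi : S -> R) :
  (forall s, measurable (X @^-1` [set s])) -> (forall s, 0 <= phi s) ->
  ('E_P[phi \o X] = \sum_s (phi s)%:E * P (X @^-1` [set s]))%E.
Proof.
move=> mX phi0; rewrite unlock.
have E w : (phi \o X) w =
    \sum_s phi s * \1_(X @^-1` [set s]) w.
  rewrite (bigD1 (X w)) //= indicE mem_set // mulr1 big1 ?addr0 // => s sX.
  rewrite indicE memNset ?mulr0 //= => /eqP; rewrite eq_sym; exact/negP.
under eq_integral do rewrite E -sumEFin.
rewrite ge0_integral_sum //; last first.
- by move=> s w _; rewrite lee_fin mulr_ge0.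
- move=> s; apply/measurable_EFinP; apply: measurable_funM => //.
apply: eq_bigr => s _.
under eq_integral do rewrite EFinM.
rewrite ge0_integralZl_EFin //.
- by rewrite integral_indic // setIT.
- by apply/measurable_EFinP.
Qed.

(** The first [k] indices are uniform on the [k]-tuples. *)
Lemma expectation_iid_uniform (n k : nat) (I : nat -> T -> 'I_n) (i0 : 'I_n)
    (phi : k.-tuple 'I_n -> R) :
  iid_uniform P I -> (forall s, 0 <= phi s) ->
  ('E_P[fun w => phi [tuple I j w | j < k]] =
   (\sum_(s : k.-tuple 'I_n) n%:R^-1 ^+ k * phi s)%R%:E)%E.
Proof.
move=> [mI pI indep] phi0.
pose J : {fset nat} := [fset j in iota 0 k]%fset.
have JP j : (j \in J) = (j < k)%N by rewrite !inE mem_iota.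
pose X w := [tuple I j w | j < k].
have XE s : X @^-1` [set s] = \bigcap_(j in [set` J]) (I j @^-1` [set nth i0 s j]).
  apply/seteqP; split=> [w /= <- j /=|w h /=].
    by rewrite JP => jk; rewrite (nth_mktuple _ i0 (Ordinal jk)).
  apply: eq_from_tnth => j; rewrite tnth_mktuple (tnth_nth i0).
  by apply: h => /=; rewrite JP.
rewrite -[fun w => _]/(phi \o X) expectation_finType //; last first.
  move=> s; rewrite XE; apply: fin_bigcap_measurable => [|j _]; last exact: mI.
  exact: finite_fset.
rewrite -sumEFin; apply: eq_bigr => s _; rewrite XE indep.
under eq_bigr do rewrite pI.
rewrite -(big_morph EFin (@EFinM R) erefl) -EFinM mulrC; congr (_ * _)%:E.
rewrite big_const_seq count_predT card_fseq undup_id ?iota_uniq // size_iota.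
by rewrite -iter_mulr_1.
Qed.

End law.
Unset Implicit Arguments.
Set Strict Implicit.

Theorem corollary3p3 (R : realType) (d n : nat) (n_gt0 : (0 < n)%N)
    (f : 'I_n -> 'rV[R]_d -> R) (L : 'I_n -> R) (mu : R)
    (xstar x0 : 'rV[R]_d)
    (disp : measure_display) (T : measurableType disp) (P : probability T R)
    (I : nat -> T -> 'I_n)
    (f_convex : forall i, convex (f i))
    (f_smooth : forall i, smooth (L i) (f i))
    (f_bounded : forall i, has_lbound (range (f i)))
    (mu_gt0 : 0 < mu)
    (favg_strongly_convex : strongly_convex mu (favg f))
    (xstar_min : minimizer (favg f) xstar)
    (I_iid : iid_uniform P I)
    (gamma : R) (gamma_gt0 : 0 < gamma) (gamma_le : gamma <= 1 / Lmax L) :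
  let step := sps_max f (1 / 2) gamma in
  let x k w := sgd f step x0 (fun j => I j w) k in
  let z k w := sgd f (const_step gamma) x0 (fun j => I j w) k in
  [/\ forall k w, step (I k w) (x k w) = gamma,
      forall k w, x k w = z k w,
      forall k, ('E_P[fun w => (enorm (x k w - xstar) ^+ 2)%R] <=
        ((1 - mu * gamma) ^+ k * enorm (x0 - xstar) ^+ 2
          + 2 * sigma2 f xstar / mu)%:E)%E &
      sigma2 f xstar = 0 ->
      forall k, ('E_P[fun w => (enorm (z k w - xstar) ^+ 2)%R] <=
        ((1 - mu * gamma) ^+ k * enorm (x0 - xstar) ^+ 2)%:E)%E].
Proof.
move=> step x z.
have M0 := Lmax_gt0 gamma_gt0 gamma_le.
have sf i : smooth (Lmax L) (f i) by apply: smooth_le (f_smooth i) (le_Lmax L i).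
have stepE i y : step i y = gamma by exact: sps_max_half (sf i) _ M0 gamma_le.
have xz k w : x k w = z k w.
  elim: k => [|k IH]; first by [].
  by rewrite /x /z /= -/(x k w) -/(z k w) stepE IH.
have main k : ('E_P[fun w => (enorm (z k w - xstar) ^+ 2)%R] <=
    ((1 - mu * gamma) ^+ k * enorm (x0 - xstar) ^+ 2
      + 2 * sigma2 f xstar / mu)%:E)%E.
  pose i0 := Ordinal n_gt0.
  pose phi (s : k.-tuple 'I_n) :=
    enorm (sgd f (const_step gamma) x0 (nth i0 s) k - xstar) ^+ 2.
  have -> : (fun w => enorm (z k w - xstar) ^+ 2) =
            (fun w => phi [tuple I j w | j < k]).
    apply/funext => w; rewrite /phi /z; congr (enorm (_ - _) ^+ 2).
    by apply: eq_sgd => j jk; rewrite (nth_mktuple _ i0 (Ordinal jk)).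
  rewrite (expectation_iid_uniform i0) // => [|s]; last exact: sqr_ge0.
  rewrite lee_fin; exact: path_average_le f_bounded favg_strongly_convex M0 _ _ _.
split=> // [k|s0 k].
  by under eq_fun do rewrite xz; exact: main.
by have := main k; rewrite s0 mulr0 mul0r addr0.
Qed.
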